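(* Let $\mathcal{H}$ be a Euclidean space, let $I,J$ be positive integers, and let $\{A_i\}_{i=1}^{I}$ and $\{B_j\}_{j=1}^{J}$ be two families of closed and convex subsets of $\mathcal{H}$. Let $\tau^{\mathcal{A}}=\{\tau_t^{\mathcal{A}}\}_{t=0}^{\infty}$ and $\tau^{\mathcal{B}}=\{\tau_t^{\mathcal{B}}\}_{t=0}^{\infty}$ be two sequences of steering parameters, and let $\alpha=(\alpha_i)_{i=1}^{I}$ and $\beta=(\beta_j)_{j=1}^{J}$ be two positive weight vectors. Assume that $A:=\bigcap_{i=1}^{I}A_i\neq\emptyset$ and $B:=\bigcap_{j=1}^{J}B_j\neq\emptyset$ but $A\cap B=\emptyset$. Assume also that there is some $\rho>0$ such that $A_i,B_j\subseteq B[0,\rho]$ for all $i\in\{1,\ldots,I\}$ and $j\in\{1,\ldots,J\}$. Further assume that there is a unique best approximation pair relative to $(A,B)$. Let $x^0\in B[0,\rho]$ and let $\{x^k\}_{k=0}^{\infty}$ be the sequence generated by the A-S-HLWB algorithm, that is, for every integer $k\geq 0$, $$x^{k+1}:=\widehat{Q}_{\mathcal{A},\tau^{\mathcal{A}},\frac{k}{2},\alpha}(x^k)\ \text{ if } k \text{ is even},\qquad x^{k+1}:=\widehat{Q}_{\mathcal{B},\tau^{\mathcal{B}},\frac{k-1}{2},\beta}(x^k)\ \text{ if } k\text{ is odd}.$$ Then $$\lim_{k\to\infty}\|x^{k+1}-x^k\|=dist(A,B),$$ and moreover the odd subsequence $\{x^{2k+1}\}_{k=0}^{\infty}$ converges to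 a point $a\in A$, the even subsequence $\{x^{2k}\}_{k=0}^{\infty}$ converges to a point $b\in B$, and $(a,b)$ is a best approximation pair relative to $(A,B)$. In particular, the conclusion holds (without separately assuming uniqueness of the best approximation pair) when all the sets $A_i$ and $B_j$, $i\in\{1,\ldots,I\}$, $j\in\{1,\ldots,J\}$, are strictly convex.
   Context: A Euclidean space is a finite-dimensional real Hilbert space. $B[x,r]:=\{y\in\mathcal{H}\mid \|x-y\|\le r\}$. $P_C$ denotes the orthogonal (nearest point) projection onto a nonempty closed convex set $C$. $dist(A,B):=\inf\{\|u-v\|\mid u\in A,\ v\in B\}$; a best approximation pair relative to $(A,B)$ is a pair $(a,b)\in A\times B$ with $\|a-b\|=dist(A,B)$. A set $C$ is strictly convex if for all distinct $x,y\in C$ and all $t\in(0,1)$ the point $tx+(1-t)y$ is in the interior of $C$. A sequence of steering parameters is a real sequence $\{\tau_k\}_{k=0}^{\infty}$ in $(0,1)$ such that $\tau_k\to 0$, $\sum_{k=0}^{\infty}\tau_k=+\infty$ and $\sum_{k=0}^{\infty}|\tau_{k+1}-\tau_k|<+\infty$. A positive weight vector is $w=(w_\ell)_{\ell=1}^{L}\in\mathbb{R}^L$ with $w_\ell>0$ for all $\ell$ and $\sum_{\ell=1}^{L}w_\ell=1$. Let $\mathcal{G}=\{C_\ell\}_{\ell=1}^{L}$ be a finite family of nonempty closed convex subsets of $\mathcal{H}$ with $\bigcap_\ell C_\ell\ne\emptyset$, let $w=(w_\ell)_{\ell=1}^L$ be a positive weight vector, and let $\tau^{\mathcal{G}}=\{\tau_t^{\mathcal{G}}\}_{t=0}^{\infty}$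 be a sequence of steering parameters. For $\tau\in(0,1)$ and an anchor point $d\in\mathcal{H}$, let $$M_{\mathcal{G},\tau,w}[d](x):=\tau d+(1-\tau)\sum_{\ell=1}^{L}w_\ell P_{C_\ell}(x),\qquad x\in\mathcal{H}.$$ For $q=0,1,2,\ldots$ let $Q_{\mathcal{G},\tau^{\mathcal{G}},q,w}[d]$ be the composition $M_{\mathcal{G},\tau_q^{\mathcal{G}},w}[d]\circ M_{\mathcal{G},\tau_{q-1}^{\mathcal{G}},w}[d]\circ\cdots\circ M_{\mathcal{G},\tau_0^{\mathcal{G}},w}[d]$ (with the same anchor $d$ in all factors), and let $$\widehat{Q}_{\mathcal{G},\tau^{\mathcal{G}},q,w}(x):=Q_{\mathcal{G},\tau^{\mathcal{G}},q,w}[x](x),\qquad x\in\mathcal{H}.$$ These are applied with $\mathcal{G}=\mathcal{A}:=\{A_i\}_{i=1}^{I}$, $w=\alpha$ and with $\mathcal{G}=\mathcal{B}:=\{B_j\}_{j=1}^{J}$, $w=\beta$. *)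

(* Defs.v *)
From HB Require Import structures.
From mathcomp Require Export all_boot all_order all_algebra.
From mathcomp Require Export all_classical all_reals all_analysis.
Export Order.TTheory GRing.Theory Num.Theory numFieldNormedType.Exports.

Set Implicit Arguments.
Unset Strict Implicit.
Unset Printing Implicit Defensive.

Local Open Scope classical_set_scope.
Local Open Scope ring_scope.

(* Completeness is not required separately: it follows from finite dimension. *)
Definition euclidean (R : realType) (H : normedModType R)
    (dot : {dot H for idfun}) : Prop :=
  (forall x : H, dot x x = `|x| ^+ 2) /\
  (exists (n : nat) (e : 'I_n -> H),
     forall x : H, exists c : 'I_n -> R, x = \sum_(i < n) c i *: e i).

Section Defs.
Variables (R : realType) (H : normedModType R).
Implicit Types (A B C : set H) (a b d x y : H).

Definition strictly_convex C : Prop :=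
  forall x y, C x -> C y -> x != y ->
  forall t : R, 0 < t < 1 -> interior C (t *: x + (1 - t) *: y).

(* The value is meaningful only where a nearest point exists and is unique,
   e.g. for nonempty closed convex C in a Euclidean space; without a nearest
   point it is the dummy value x. *)
Definition proj C x : H :=
  xget x [set p | C p /\ forall y, C y -> `|x - p| <= `|x - y|].

Definition dist A B : R := inf [set `|u - v| | u in A & v in B].

Definition best_approx_pair A B (ab : H * H) : Prop :=
  [/\ A ab.1, B ab.2 & `|ab.1 - ab.2| = dist A B].

Definition steering_parameters (tau : R ^nat) : Prop :=
  [/\ forall k, 0 < tau k < 1,
      tau @ \oo --> (0 : R),
      series tau @ \oo --> +oo &
      cvgn (series (fun k => `|tau k.+1 - tau k| : R))].

Definition positive_weights (n : nat) (w : 'I_n -> R) : Prop :=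
  (forall i, 0 < w i) /\ \sum_(i < n) w i = 1.

Section HLWB.
Variables (n : nat) (G : 'I_n -> set H) (tau : R ^nat) (w : 'I_n -> R).

Definition opM (t : R) d x : H :=
  t *: d + (1 - t) *: \sum_(l < n) w l *: proj (G l) x.

(* q.+1 factors: opM (tau q) d \o ... \o opM (tau 0) d. *)
Fixpoint opQ (q : nat) d : H -> H :=
  if q is q'.+1 then opM (tau q) d \o opQ q' d else opM (tau 0%N) d.

Definition opQhat (q : nat) x : H := opQ q x x.

End HLWB.
End Defs.

(* Main.v *)
(* All the maps involved are nonexpansive. For a fixed anchor d, the HLWB
   iteration y_(k+1) = tau_k d + (1 - tau_k) T y_k, with T the weighted average
   of the projections, is a Halpern iteration of T, whose fixed point set is the
   intersection C of the sets; it converges to P_C d. As x |-> Q^_q x is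
   nonexpansive, this convergence is uniform on the compact ball B[0, rho].
   Hence x^(2k+2) = P_B P_A x^(2k) + o(1). At a point z of B other than the
   B-component b of the best approximation pair, P_B P_A strictly decreases the
   distance to b, by compactness at least by a fixed amount when z is far from
   b; this decrease absorbs the (not necessarily summable) errors o(1). *)
Require Import Defs.
From mathcomp Require Import ring lra.

Set Implicit Arguments.
Unset Strict Implicit.
Unset Printing Implicit Defensive.

Local Open Scope classical_set_scope.
Local Open Scope ring_scope.

(** * Inner products and compactness of balls *)

Section InnerProduct.
Variables (R : realType) (H : normedModType R) (dot : {dot H for idfun}).
Implicit Types (x y z u v : H).

Lemma dotC x y : dot x y = dot y x.
Proof. by rewrite (hermC dot x y) /= expr0 mul1r. Qed.

Lemma dotDl x y z : dot (x + y) z = dot x z + dot y z.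
Proof. exact: linearDl. Qed.

Lemma dotDr x y z : dot z (x + y) = dot z x + dot z y.
Proof. exact: linearDr. Qed.

Lemma dotNl x z : dot (- x) z = - dot x z.
Proof. exact: linearNl. Qed.

Lemma dotNr x z : dot z (- x) = - dot z x.
Proof. exact: linearNr. Qed.

Lemma dotZl (a : R) x z : dot (a *: x) z = a * dot x z.
Proof. exact: linearZl_LR. Qed.

Lemma dotZr (a : R) x z : dot z (a *: x) = a * dot z x.
Proof. by rewrite dotC dotZl dotC. Qed.

Lemma dot0l z : dot 0 z = 0.
Proof. exact: linear0l. Qed.

Lemma dot_suml (I : Type) (r : seq I) (P : pred I) (E : I -> H) z :
  dot (\sum_(i <- r | P i) E i) z = \sum_(i <- r | P i) dot (E i) z.
Proof. exact: linear_sumlz. Qed.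

Definition dotE := (dot0l, dotDl, dotDr, dotNl, dotNr, dotZl, dotZr).

Hypothesis dotxx : forall x, dot x x = `|x| ^+ 2.

Lemma sqrnormD x y : `|x + y| ^+ 2 = `|x| ^+ 2 + `|y| ^+ 2 + 2 * dot x y.
Proof. by rewrite -!dotxx !dotE [dot y x]dotC; ring. Qed.

Lemma dot_inj u v : (forall z, dot u z = dot v z) -> u = v.
Proof.
move=> uv; apply/eqP; rewrite -subr_eq0 -normr_eq0 -sqrf_eq0 -dotxx.
by rewrite dotDl dotNl uv subrr.
Qed.

Lemma dot_polar x y : dot x y = (`|x + y| ^+ 2 - `|x| ^+ 2 - `|y| ^+ 2) / 2.
Proof. by rewrite sqrnormD; field. Qed.

(** A weak Cauchy-Schwarz inequality, from $\|x+y\|^2\ge 0$ and $\|x-y\|^2\ge 0$; it suffices to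
    bound coordinates on a ball. *)
Lemma ler_dot_sqr x y : `|dot x y| <= (`|x| ^+ 2 + `|y| ^+ 2) / 2.
Proof.
have := sqrnormD x y; have := sqrnormD x (- y).
rewrite dotNr normrN => e1 e2.
have := sqr_ge0 `|x + y|; have := sqr_ge0 `|x - y|.
by rewrite ler_norml e1 e2 => h1 h2; apply/andP; split; lra.
Qed.

(** Polarization reduces this to the continuity of the norm. *)
Lemma dot_continuous x y : continuous (fun z => dot x (z - y)).
Proof.
under eq_fun do rewrite dot_polar.
move=> z.
have nc (f : H -> H) : f w @[w --> z] --> f z ->
    `|f w| ^+ 2 @[w --> z] --> `|f z| ^+ 2.
  move=> cf; rewrite expr2; under eq_fun do rewrite expr2.
  by apply: cvgM; apply: cvg_norm.
apply: cvgM; last exact: cvg_cst.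
apply: cvgB; first apply: cvgB.
- apply: (nc (fun w => x + (w - y))).
  by apply: cvgD; [exact: cvg_cst|apply: cvgB; [exact: cvg_id|exact: cvg_cst]].
- exact: cvg_cst.
- by apply: (nc (fun w => w - y)); apply: cvgB; [exact: cvg_id|exact: cvg_cst].
Qed.

(* Gram-Schmidt, phrased through the map x |-> \sum_(u <- s) <x, u> u, which
   is the orthogonal projection onto the span of s. *)
Lemma orthonormalization (es : seq H) : exists s : seq H,
  [/\ forall u, u \in s -> `|u| <= 1,
      forall x u, u \in s -> dot (x - \sum_(v <- s) dot x v *: v) u = 0 &
      forall e, e \in es -> e = \sum_(v <- s) dot e v *: v].
Proof.
elim: es => [|v es [s [s1 sO sE]]]; first by exists [::].
pose v' := v - \sum_(u <- s) dot v u *: u.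
(* If [v'] vanishes, [v] is already in the span of [s]; otherwise its normalization [w] is added. *)
have [v'0|v'0] := eqVneq v' 0.
  exists s; split => // e; rewrite inE => /predU1P[->|/sE//].
  by apply/eqP; rewrite -subr_eq0 -/v' v'0.
have nv' : `|v'| != 0 by rewrite normr_eq0.
pose w := `|v'|^-1 *: v'.
have ws u : u \in s -> dot w u = 0 by move=> us; rewrite dotZl sO// mulr0.
have sw (c : H -> R) : dot (\sum_(u <- s) c u *: u) w = 0.
  rewrite dot_suml big_seq big1// => u us.
  by rewrite dotZl dotC ws// mulr0.
have ww : dot w w = 1.
  by rewrite dotZl dotZr dotxx; field.
have v'w : v' = `|v'| *: w by rewrite scalerA divff// scale1r.
exists (w :: s); split.
- move=> u; rewrite inE => /predU1P[->|/s1//].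
  by rewrite normrZ normfV normr_id mulVf.
- move=> x u; rewrite inE big_cons => /predU1P[->|us].
    by rewrite dotDl dotNl dotDl (dotZl (dot x w) w) ww mulr1 sw addr0 subrr.
  by rewrite opprD addrCA dotDl dotNl (dotZl _ w) ws// sO// mulr0 oppr0 addr0.
- move=> e; rewrite inE big_cons => /predU1P[->|ees].
    have -> : dot v w = `|v'|.
      have -> : v = v' + \sum_(u <- s) dot v u *: u by rewrite subrK.
      by rewrite dotDl sw addr0 {1}v'w dotZl ww mulr1.
    by rewrite -v'w subrK.
  (* A vector expanded over [s] is orthogonal to [w], so the new term vanishes. *)
  by rewrite {2}(sE _ ees) sw scale0r add0r; exact: sE.
Qed.

Hypothesis finH : exists (n : nat) (e : 'I_n -> H),
  forall x, exists c : 'I_n -> R, x = \sum_(i < n) c i *: e i.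

(** Orthonormalization reproduces each spanning vector by its expansion over [s]; linearity extends
    this to all of [H]. *)
Lemma parseval_frame : exists s : seq H,
  (forall u, u \in s -> `|u| <= 1) /\
  (forall x, x = \sum_(v <- s) dot x v *: v).
Proof.
have [n [e spane]] := finH.
have [s [s1 _ sE]] := orthonormalization [seq e i | i <- enum 'I_n].
exists s; split => // x; have [c xE] := spane x.
rewrite [in RHS]xE; under eq_bigr do rewrite dot_suml scaler_suml.
rewrite exchange_big xE; apply: eq_bigr => i _ /=.
rewrite {1}(sE (e i)); last by rewrite map_f// mem_enum.
by rewrite scaler_sumr; apply: eq_bigr => v _; rewrite dotZl scalerA.
Qed.

(** The ball is a closed subset of the continuous image of a compact box of coordinates. *)
Lemma compact_closed_ball0 (rho : R) : compact (closed_ball_ Num.norm (0 : H) rho).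
Proof.
have [s [s1 sE]] := parseval_frame.
pose n := size s.
(* The bound of [ler_dot_sqr] for $\|x\|\le\rho$ and $\|u\|\le 1$. *)
pose M := (rho ^+ 2 + 1) / 2.
pose K := [set v : 'rV[R]_n | forall i, `[- M, M]%classic (v ord0 i)].
have cK : compact K.
  by apply: (@rV_compact _ _ (fun=> `[- M, M]%classic)) => _; apply: segment_compact.
pose g (v : 'rV[R]_n) : H := \sum_(i < n) v ord0 i *: s`_i.
have cg : continuous g.
  apply: continuous_big => [|i _ v]; first exact: add_continuous.
  apply: (@cvgZr_tmp _ _ _ (nbhs v) (nbhs_filter v) (fun w : 'rV[R]_n => w ord0 i)).
  exact: (@coord_continuous _ _ _ ord0 i v).
apply: (subclosed_compact _ (continuous_compact (continuous_subspaceT cg) cK)).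
  exact: closed_closed_ball_.
move=> x; rewrite /closed_ball_/= sub0r normrN => xrho.
exists (\row_(i < n) dot x s`_i) => /=; last first.
  rewrite /g {2}(sE x) (big_nth 0) big_mkord.
  by apply: eq_bigr => i _; rewrite mxE.
move=> i /=; rewrite mxE in_itv/= -ler_norml.
apply: le_trans (ler_dot_sqr _ _) _.
have := s1 _ (mem_nth 0 (ltn_ord i)) => u1.
rewrite ler_pM2r ?invr_gt0// lerD//.
  by rewrite lerXn2r ?nnegrE// (le_trans _ xrho).
by rewrite -[leRHS](expr1n _ 2) lerXn2r ?nnegrE.
Qed.

End InnerProduct.

(* An identity between linear combinations becomes a ring identity once both
   sides are paired with an arbitrary vector. *)
Ltac vector_ring dotxx := apply: (dot_inj dotxx) => ?; rewrite !dotE; ring.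

(** * Projections *)

Lemma convex_set_combine (R : realType) (H : normedModType R) (C : set H)
    (x y : H) (t : R) :
  convex_set C -> C x -> C y -> 0 <= t <= 1 -> C (t *: x + (1 - t) *: y).
Proof.
move=> vC Cx Cy /andP[t0 t1].
have := vC x y (Itv01 t0 t1); rewrite !inE; exact.
Qed.

Section Projection.
Variables (R : realType) (H : normedModType R) (dot : {dot H for idfun}).
Hypothesis dotxx : forall x, dot x x = `|x| ^+ 2.
Implicit Types (x y c p q : H) (C : set H).

Definition nearest C x p := C p /\ forall y, C y -> `|x - p| <= `|x - y|.

(** Variational inequality: if it failed, moving from [p] towards [c] inside [C] would come closer
    to [x]. *)
Lemma nearest_dot_le0 C x p c : convex_set C -> nearest C x p -> C c ->
  dot (x - p) (c - p) <= 0.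
Proof.
move=> vC [Cp pmin] Cc; rewrite leNgt; apply/negP => d0.
set d := dot _ _ in d0.
pose N := `|c - p| ^+ 2; have N0 : 0 <= N by exact: sqr_ge0.
have dN : 0 < d + N by lra.
(* Then $t\le 1$ and $tN<2d$, so $\|x-p\|^2-2td+t^2N<\|x-p\|^2$. *)
pose t := d / (d + N).
have t0 : 0 < t by rewrite divr_gt0.
have t1 : t <= 1 by rewrite ler_pdivrMr// mul1r; lra.
have tN : t * (d + N) = d by rewrite divfK// gt_eqF.
have := pmin _ (convex_set_combine vC Cc Cp (_ : 0 <= t <= 1)).
rewrite (ltW t0) t1 => /(_ isT).
have -> : x - (t *: c + (1 - t) *: p) = (x - p) + (- t) *: (c - p).
  by vector_ring dotxx.
rewrite -(@ler_pXn2r _ 2) ?nnegrE// (sqrnormD dotxx (x - p)) normrZ normrN gtr0_norm//.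
by rewrite dotZr -/d exprMn -/N => h; nra.
Qed.

(** Adding the variational inequalities of [p] and [q], each tested at the other point, gives
    $\|p-q\|^2\le 0$. *)
Lemma nearest_uniq C x p q : convex_set C ->
  nearest C x p -> nearest C x q -> p = q.
Proof.
move=> vC np nq; apply/eqP; rewrite -subr_eq0 -normr_eq0 -sqrf_eq0.
have := nearest_dot_le0 vC np nq.1; have := nearest_dot_le0 vC nq np.1.
rewrite eq_le sqr_ge0 andbT -dotxx !dotE [dot q p](dotC dot) => h1 h2.
by lra.
Qed.

Lemma nearest_proj C x : compact C -> C !=set0 -> nearest C x (proj C x).
Proof.
move=> cC neC; apply: (@xgetPex _ x [set p | nearest C x p]).
have [|p] := @compact_EVT_min _ _ (fun y => `|x - y|) _ neC cC.
  apply: continuous_subspaceT => y; apply: cvg_norm.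
  by apply: cvgB; [exact: cvg_cst|exact: cvg_id].
by rewrite inE => Cp pmin; exists p; split=> // y Cy; apply: pmin; rewrite inE.
Qed.

Lemma proj_eq C x p : convex_set C -> nearest C x p -> proj C x = p.
Proof.
move=> vC np; apply: (nearest_uniq vC _ np).
by apply: (@xgetPex _ x [set p | nearest C x p]); exists p.
Qed.

Lemma proj_id C x : convex_set C -> C x -> proj C x = x.
Proof. by move=> vC Cx; apply: proj_eq => //; split=> // y _; rewrite subrr normr0. Qed.

Section ConvexBody.
Variable C : set H.
Hypotheses (cC : compact C) (vC : convex_set C) (neC : C !=set0).

Lemma proj_in x : C (proj C x).
Proof. exact: (nearest_proj x cC neC).1. Qed.

Lemma proj_dot_le0 x c : C c -> dot (x - proj C x) (c - proj C x) <= 0.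
Proof. by apply: nearest_dot_le0 => //; exact: nearest_proj. Qed.

(** Firm nonexpansiveness: two variational inequalities add up to $\|p-q\|^2\le\langle
    x-y,p-q\rangle$ for the projections $p,q$. The second square serves the equality case in
    [alternating_proj_lt]. *)
Lemma proj_firm x y : `|proj C x - proj C y| ^+ 2 +
  `|(x - y) - (proj C x - proj C y)| ^+ 2 <= `|x - y| ^+ 2.
Proof.
have := proj_dot_le0 x (proj_in y); have := proj_dot_le0 y (proj_in x).
set p := proj C x; set q := proj C y.
rewrite -!dotxx !dotE !(dotC dot y x) !(dotC dot q p) !(dotC dot p x).
rewrite !(dotC dot q x) !(dotC dot p y) !(dotC dot q y) => h1 h2.
by nra.
Qed.

Lemma proj_nonexp x y : `|proj C x - proj C y| <= `|x - y|.
Proof.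
rewrite -(@ler_pXn2r _ 2) ?nnegrE//; apply: le_trans (proj_firm x y).
by rewrite lerDl sqr_ge0.
Qed.

End ConvexBody.
End Projection.

(** * A recursion driven by steering parameters *)

Section SteeringRecursion.
Variable R : realType.
Implicit Types (tau s b g : R ^nat).

(** An elementary substitute for $\prod(1-\tau_k)\le\exp(-\sum\tau_k)$; the induction step is
    $(1-t)(1+S+t)=1+S-t(S+t)\le 1+S$. *)
Lemma prod_one_minus_le tau (m n : nat) : (forall k, 0 < tau k < 1) ->
  (\prod_(m <= k < m + n) (1 - tau k)) * (1 + \sum_(m <= k < m + n) tau k) <= 1.
Proof.
move=> tau01; elim: n => [|n IH]; first by rewrite addn0 !big_geq// mul1r addr0.
have mn : (m <= m + n)%N by rewrite leq_addr.
rewrite addnS !big_nat_recr//=.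
have /andP[t0 t1] := tau01 (m + n)%N.
set P := \prod_(_ <= _ < _) _ in IH *; set S := \sum_(_ <= _ < _) _ in IH *.
have P0 : 0 <= P.
  apply: prodr_ge0 => k _; have /andP[_ /ltW] := tau01 k.
  by rewrite subr_ge0.
have S0 : 0 <= S by apply: sumr_ge0 => k _; have /andP[/ltW] := tau01 k.
have tS : 0 <= tau (m + n)%N * (S + tau (m + n)%N).
  by apply: mulr_ge0; rewrite ?addr_ge0// ltW.
have Pt := mulr_ge0 P0 tS.
by apply: le_trans IH; nra.
Qed.

Lemma prod_one_minus_cvg0 tau (m : nat) : (forall k, 0 < tau k < 1) ->
  series tau @ \oo --> +oo ->
  forall e, 0 < e ->
  \forall n \near \oo, \prod_(m <= k < m + n) (1 - tau k) <= e.
Proof.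
move=> tau01 /cvgryPge st e e0.
(* The head of the series is added so that the sum starting at [m] still exceeds $1/e$. *)
have [N _ hN] := st (e^-1 + \sum_(0 <= k < m) tau k).
exists N => // n /= Nn.
have := hN (m + n)%N (leq_trans Nn (leq_addl _ _)).
rewrite /series/= (@big_cat_nat _ _ _ m 0 (m + n))//= ?leq_addr// => h.
have := prod_one_minus_le m n tau01.
set P := \prod_(_ <= _ < _) _; set S := \sum_(m <= _ < _) _ in h * => PS.
have S1 : e^-1 <= 1 + S by lra.
have e10 : 0 < e^-1 by rewrite invr_gt0.
rewrite -[leRHS]invrK -[leRHS]mul1r ler_pdivlMr//.
apply: le_trans PS; apply: ler_wpM2l => //.
apply: prodr_ge0 => k _; have /andP[_ /ltW] := tau01 k.
by rewrite subr_ge0.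
Qed.

(** From some [N] on, [b] and the tails of [g] are at most $e/3$; unrolling the recursion leaves
    [s N] times a product that tends to 0. *)
Lemma steering_recursion tau s b g : (forall k, 0 < tau k < 1) ->
  series tau @ \oo --> +oo -> cvgn (series g) ->
  (forall k, 0 <= s k) -> (forall k, 0 <= g k) ->
  (forall e, 0 < e -> \forall k \near \oo, b k <= e) ->
  (forall k, s k.+1 <= (1 - tau k) * s k + tau k * b k + g k) ->
  s @ \oo --> 0.
Proof.
move=> tau01 stau cg s0 g0 b0 srec; apply/cvgrPdist_le => e e0.
have e3 : 0 < e / 3 by rewrite divr_gt0.
have [N1 _ hN1] := b0 _ e3.
have /cauchy_cvgP/cauchy_seriesP := cg.
move=> /(_ _ e3)[[U1 U2] [[N2 _ hU1] [N3 _ hU2]] hU].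
pose N := maxn N1 (maxn N2 N3).
have gN n : \sum_(N <= k < N + n) g k <= e / 3.
  apply: le_trans (ler_norm _) (ltW _); apply: (hU (N, N + n)%N); split => /=.
    by apply: hU1; rewrite /= /N !leq_max leqnn orbT.
  by apply: hU2; rewrite /= (@leq_trans N)// ?leq_addr// /N !leq_max leqnn !orbT.
(* The term $e/3$ is preserved, since $(1-\tau)e/3+\tau e/3=e/3$. *)
have ind n : s (N + n)%N <= \prod_(N <= k < N + n) (1 - tau k) * s N + e / 3
    + \sum_(N <= k < N + n) g k.
  elim: n => [|n IH]; first by rewrite addn0 !big_geq// mul1r addr0 lerDl ltW.
  have Nn : (N <= N + n)%N by rewrite leq_addr.
  rewrite addnS !big_nat_recr//=; apply: le_trans (srec _) _.
  have /andP[t0 t1] := tau01 (N + n)%N.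
  have : b (N + n)%N <= e / 3.
    by apply: hN1; rewrite /= (leq_trans _ Nn)// /N leq_max leqnn.
  have : 0 <= \sum_(N <= k < N + n) g k by apply: sumr_ge0.
  move: (\sum_(_ <= _ < _) _) IH => G; move: (\prod_(_ <= _ < _) _) => P.
  move: (s _) (s N) (b _) (g _) (tau _) t0 t1 => sn sN bn gn t t0 t1 IH G0 bn0.
  have := ler_wpM2l (ltW t0) bn0.
  have : 0 <= 1 - t by lra.
  move=> /ler_wpM2l => /(_ _ _ IH).
  have := mulr_ge0 (ltW t0) G0.
  by nra.
(* The denominator is [1 + s N] because [s N] may vanish. *)
have eN : 0 < e / 3 / (1 + s N) by rewrite divr_gt0// ltr_pwDl.
have [M _ hM] := prod_one_minus_cvg0 N tau01 stau eN.
exists (N + M)%N => // k /= NMk.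
have Nk : (N <= k)%N by apply: leq_trans NMk; exact: leq_addr.
rewrite sub0r normrN ger0_norm//.
have := ind (k - N)%N; have := gN (k - N)%N; have := hM (k - N)%N.
rewrite /= leq_subRL// NMk subnKC// => /(_ isT) Pk gk sk.
have : \prod_(N <= k0 < k) (1 - tau k0) * s N <= e / 3.
  apply: le_trans (_ : e / 3 / (1 + s N) * s N <= _).
    exact: ler_wpM2r.
  rewrite mulrAC ler_pdivrMr ?ltr_pwDl// ler_wpM2l ?(ltW e3)//.
  by rewrite lerDr.
by move=> h; lra.
Qed.

End SteeringRecursion.

(** * Halpern iteration of averaged projections *)

(** The minimum is attained on a compact set; this turns pointwise strict inequalities into uniform
    gaps. *)
Lemma compact_ball_lower_bound (R : realType) (H : normedModType R)
    (rho : R) (cB : compact (closed_ball_ Num.norm (0 : H) rho))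
    (K : set H) (f : H -> R) :
  closed K -> continuous f ->
  (forall z, `|z| <= rho -> K z -> 0 < f z) ->
  exists2 eta, 0 < eta & forall z, `|z| <= rho -> K z -> eta <= f z.
Proof.
move=> cK cf f0.
have [[z0 z0K]|] := pselect ((closed_ball_ Num.norm 0 rho `&` K) !=set0); last first.
  (* On an empty intersection any positive constant works. *)
  move=> neK; exists 1 => // z zrho Kz; case: neK; exists z.
  by rewrite /closed_ball_/= sub0r normrN.
have cBK := compact_closedI cB cK.
have [c + cmin] :=
  compact_EVT_min (ex_intro _ z0 z0K) cBK (continuous_subspaceT cf).
rewrite inE => -[]; rewrite /closed_ball_/= sub0r normrN => crho Kc.
exists (f c) => [|z zrho Kz]; first exact: f0.
by apply: cmin; rewrite inE; split => //; rewrite /closed_ball_/= sub0r normrN.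
Qed.

Section Halpern.
Variables (R : realType) (H : normedModType R) (dot : {dot H for idfun}).
Hypothesis dotxx : forall x, dot x x = `|x| ^+ 2.
Variable rho : R.
Hypothesis cB : compact (closed_ball_ Num.norm (0 : H) rho).
Variables (n : nat) (G : 'I_n -> set H) (tau : R ^nat) (w : 'I_n -> R).
Hypotheses (tauP : steering_parameters tau) (wP : positive_weights w).
Hypotheses (cG : forall l, compact (G l)) (vG : forall l, convex_set (G l)).
Hypothesis G_ball : forall l x, G l x -> `|x| <= rho.
Let C := \bigcap_l G l.
Hypothesis neC : C !=set0.

Let neG l : G l !=set0.
Proof. by have [c Cc] := neC; exists c; exact: Cc. Qed.

Lemma bigcap_convex : convex_set C.
Proof.
move=> x y t; rewrite !inE => Cx Cy l _.
by have := @vG l x y t; rewrite !inE; apply; [exact: Cx|exact: Cy].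
Qed.

Lemma closed_bigcap_compact : (0 < n)%N -> compact C.
Proof.
move=> n0; apply: (@subclosed_compact _ _ (G (Ordinal n0))) => //.
  by apply: closed_bigI => l _; apply: compact_closed => //; exact: norm_hausdorff.
by move=> x; apply.
Qed.

Definition avg_proj x : H := \sum_(l < n) w l *: proj (G l) x.
Local Notation T := avg_proj.

Let w_ge0 l : 0 <= w l. Proof. exact: ltW (wP.1 l). Qed.

Lemma avg_proj_nonexp x y : `|T x - T y| <= `|x - y|.
Proof.
rewrite -sumrB -[leRHS]mul1r -wP.2 mulr_suml.
apply: le_trans (ler_norm_sum _ _ _) _; apply: ler_sum => l _.
rewrite -scalerBr normrZ ger0_norm// ler_wpM2l//.
exact: (proj_nonexp dotxx).
Qed.

Lemma avg_proj_ball x : `|T x| <= rho.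
Proof.
rewrite -[leRHS]mul1r -wP.2 mulr_suml.
apply: le_trans (ler_norm_sum _ _ _) _; apply: ler_sum => l _.
rewrite normrZ ger0_norm// ler_wpM2l//.
by apply: (@G_ball l); exact: proj_in.
Qed.

Lemma avg_proj_fix c : C c -> T c = c.
Proof.
move=> Cc; rewrite -[RHS]scale1r -wP.2 scaler_suml; apply: eq_bigr => l _.
by rewrite (proj_id dotxx)//; exact: Cc.
Qed.

(** For a common point $c$, the variational inequalities give $\sum w_l\|z-P_lz\|^2\le\langle
    z-Tz,z-c\rangle=0$, so every residual vanishes. *)
Lemma avg_proj_fixP z : T z = z -> C z.
Proof.
move=> Tz; have [c Cc] := neC.
have zT : \sum_(l < n) w l *: (z - proj (G l) z) = 0.
  under eq_bigr do rewrite scalerBr.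
  by rewrite sumrB -scaler_suml wP.2 scale1r -/(T z) Tz subrr.
have : \sum_(l < n) w l * `|z - proj (G l) z| ^+ 2 <= 0.
  rewrite -[leRHS](dot0l dot (z - c)) -zT dot_suml; apply: ler_sum => l _.
  rewrite dotZl ler_wpM2l//.
  have := proj_dot_le0 dotxx (@cG l) (@vG l) (neG l) z (Cc l I).
  rewrite -!dotxx; set p := proj _ _; rewrite !dotE => h.
  rewrite ?(dotC dot p z) ?(dotC dot p c) in h *.
  by lra.
move=> le0 l _.
have : \sum_(l < n) w l * `|z - proj (G l) z| ^+ 2 == 0.
  by rewrite eq_le le0 sumr_ge0// => i _; rewrite mulr_ge0// sqr_ge0.
rewrite psumr_eq0; last by move=> i _; rewrite mulr_ge0// sqr_ge0.
move=> /allP/(_ l (mem_index_enum _)) /=.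
rewrite mulf_eq0 gt_eqF ?wP.1//= sqrf_eq0 normr_eq0 subr_eq0 => /eqP ->.
exact: proj_in.
Qed.

Lemma avg_proj_continuous : continuous T.
Proof.
move=> x; apply/cvgrPdist_le => e e0.
near=> y; apply: le_trans (avg_proj_nonexp _ _) _; near: y.
by apply: cvgr_dist_le => //; exact: cvg_id.
Unshelve. all: by end_near. Qed.

Lemma opM_ball t d x : 0 < t < 1 -> `|d| <= rho -> `|opM G w t d x| <= rho.
Proof.
move=> /andP[t0 t1] drho; apply: le_trans (ler_normD _ _) _.
rewrite !normrZ !gtr0_norm ?subr_gt0//.
have := ler_wpM2l (ltW t0) drho.
have : (1 - t) * `|T x| <= (1 - t) * rho.
  by rewrite ler_wpM2l ?avg_proj_ball// subr_ge0 ltW.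
by rewrite -/(T x) => h1 h2; lra.
Qed.

(** Anchor and starting point vary together, which for [x = d] and [y = e] makes [opQhat]
    nonexpansive. *)
Lemma opQ_nonexp q d e x y : `|x - y| <= `|d - e| ->
  `|opQ G tau w q d x - opQ G tau w q e y| <= `|d - e|.
Proof.
have [tau01 _ _ _] := tauP.
have step t x' y' : 0 < t < 1 -> `|x' - y'| <= `|d - e| ->
    `|opM G w t d x' - opM G w t e y'| <= `|d - e|.
  move=> /andP[t0 t1] xy; rewrite /opM opprD addrACA -!scalerBr.
  apply: le_trans (ler_normD _ _) _.
  rewrite !normrZ !gtr0_norm ?subr_gt0//.
  have : (1 - t) * `|T x' - T y'| <= (1 - t) * `|d - e|.
    rewrite ler_wpM2l ?subr_ge0 ?(ltW t1)//.
    exact: le_trans (avg_proj_nonexp _ _) xy.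
  by rewrite -!/(T _) => h; lra.
by move=> xy; elim: q => [|q IH] /=; apply: step.
Qed.

Lemma opQ_ball q d x : `|d| <= rho -> `|opQ G tau w q d x| <= rho.
Proof.
have [tau01 _ _ _] := tauP.
by move=> drho; case: q => [|q]; apply: opM_ball.
Qed.

Section Orbit.
Variables d x : H.
Hypotheses (d_ball : `|d| <= rho) (x_ball : `|x| <= rho).

(** The index is shifted so that [y 0] is the starting point and [tau k] drives the step from [y k]
    to [y k.+1]. *)
Let y k := if k is k'.+1 then opQ G tau w k' d x else x.

Let yS k : y k.+1 = tau k *: d + (1 - tau k) *: T (y k).
Proof. by case: k. Qed.

Let y_ball k : `|y k| <= rho.
Proof. by case: k => [|k]//=; exact: opQ_ball. Qed.

Let anchor_bound k : `|d - T (y k)| <= 2 * rho.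
Proof.
apply: le_trans (ler_normB _ _) _.
by rewrite mulr_natl mulr2n lerD// avg_proj_ball.
Qed.

(** Successive steps contract by $1-\tau_k$ up to an error $2\rho|\tau_{k+1}-\tau_k|$, summable by
    bounded variation of the parameters. *)
Let step_cvg0 : `|y k.+1 - y k| @[k --> \oo] --> 0.
Proof.
have [tau01 _ stau cdtau] := tauP.
apply: (@steering_recursion _ tau _ (fun=> 0)
  (fun k => (2 * rho) * `|tau k.+1 - tau k|)) => //.
- exact: is_cvg_seriesZ.
- move=> k; rewrite mulr_ge0// (le_trans _ (anchor_bound 0)) //.
- by move=> e e0; near=> k; exact: ltW.
move=> k; have /andP[t0 t1] := tau01 k.
have -> : y k.+2 - y k.+1 = (tau k.+1 - tau k) *: (d - T (y k.+1)) +
    (1 - tau k) *: (T (y k.+1) - T (y k)).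
  by rewrite (yS k.+1) {2}(yS k); vector_ring dotxx.
apply: le_trans (ler_normD _ _) _; rewrite !normrZ mulr0 addr0 addrC lerD//.
  by rewrite gtr0_norm ?subr_gt0// ler_wpM2l ?avg_proj_nonexp// subr_ge0 ltW.
by rewrite mulrC ler_wpM2r.
Unshelve. all: by end_near. Qed.

(** The residual differs from a step of the orbit by $\tau_k(d-Ty_k)$, which tends to 0. *)
Let fix_cvg0 : `|y k - T (y k)| @[k --> \oo] --> 0.
Proof.
have [tau01 tau0 _ _] := tauP.
have lim0 : `|y k.+1 - y k| + tau k * (2 * rho) @[k --> \oo] --> 0.
  rewrite -[0]addr0 -[X in _ + X](mul0r (2 * rho)).
  by apply: cvgD; [exact: step_cvg0|apply: cvgM; [exact: tau0|exact: cvg_cst]].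
apply: (@squeeze_cvgr _ _ _ _ (fun=> 0) _ _ _ 0 _ lim0) => //; last first.
  exact: cvg_cst.
near=> k.
rewrite normr_ge0/= distrC.
have /andP[t0 t1] := tau01 k.
have -> : T (y k) - y k = (y k.+1 - y k) - tau k *: (d - T (y k)).
  by rewrite yS; vector_ring dotxx.
apply: le_trans (ler_normB _ _) _; rewrite lerD2l normrZ gtr0_norm//.
by rewrite ler_wpM2l// ltW.
Unshelve. all: by end_near. Qed.

Lemma opQ_cvg : (0 < n)%N -> opQ G tau w k d x @[k --> \oo] --> proj C d.
Proof.
move=> n0; have [tau01 _ stau _] := tauP.
have cC := closed_bigcap_compact n0; have vC := bigcap_convex.
set p := proj C d.
(* On the part [K] of the ball where the product is at least $e/2$, the variational inequality for
   [p] excludes fixed points of [T]. Residuals there are bounded below, so the orbit eventually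
   avoids [K]. *)
have sl e : 0 < e -> \forall k \near \oo, 2 * dot (d - p) (y k.+1 - p) <= e.
  move=> e0; pose K := [set z | e / 2 <= dot (d - p) (z - p)].
  have clK : closed K.
    have /continuous_closedP cf := @dot_continuous _ _ _ dotxx (d - p) p.
    exact: (cf _ (@closed_ge _ (e / 2))).
  have [|z zrho Kz|eta eta0 etaP] := @compact_ball_lower_bound _ _ _ cB K
    (fun z => `|z - T z|) clK.
  - move=> z; apply: cvg_norm; apply: cvgB; first exact: cvg_id.
    exact: avg_proj_continuous.
  - rewrite normr_gt0 subr_eq0; apply/eqP => zT.
    have := proj_dot_le0 dotxx cC vC neC d (avg_proj_fixP (esym zT)).
    by move: Kz; rewrite /K/= -/p; lra.
  have /cvgrPdist_lt/(_ _ eta0)[N _ hN] := fix_cvg0.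
  exists N => // k /= Nk; have /= := hN k.+1 (leqW Nk).
  rewrite sub0r normrN normr_id => yT; rewrite leNgt; apply/negP => hd.
  have : eta <= `|y k.+1 - T (y k.+1)| by apply: etaP => //; rewrite /K/=; lra.
  by rewrite leNgt yT.
have sq0 : `|y k - p| ^+ 2 @[k --> \oo] --> 0.
  apply: (@steering_recursion _ tau _ (fun k => 2 * dot (d - p) (y k.+1 - p))
    (fun=> 0)) => //.
    rewrite (_ : series _ = fun=> 0); first exact: is_cvg_cst.
    by apply/funext => k; rewrite /series/= big1.
  move=> k; have /andP[t0 t1] := tau01 k; rewrite addr0.
  have Tp : T p = p by apply: avg_proj_fix; exact: proj_in.
  have : `|T (y k) - p| ^+ 2 <= `|y k - p| ^+ 2.
    by rewrite lerXn2r ?nnegrE// -{1}Tp avg_proj_nonexp.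
  have -> : y k.+1 - p = tau k *: (d - p) + (1 - tau k) *: (T (y k) - p).
    by rewrite yS; vector_ring dotxx.
  (* What remains is $\|ta+(1-t)b\|^2\le(1-t)\|b\|^2+2t\langle a,ta+(1-t)b\rangle$; the gap is
     $t^2\|a\|^2+t(1-t)\|b\|^2$. *)
  move: (d - p) (T (y k) - p) (tau k) t0 t1 => a b t t0 t1.
  rewrite -[X in X <= _ -> _]dotxx -[X in _ -> X <= _]dotxx.
  rewrite !dotE (dotC dot b a) => bb.
  have aa : 0 <= dot a a by rewrite dotxx sqr_ge0.
  have bb0 : 0 <= dot b b by rewrite dotxx sqr_ge0.
  have t1' : 0 <= 1 - t by lra.
  have := ler_wpM2l t1' bb.
  have := mulr_ge0 (mulr_ge0 (ltW t0) t1') bb0.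
  have := mulr_ge0 (sqr_ge0 t) aa.
  by lra.
apply/cvgrPdist_lt => e e0.
have /cvgrPdist_lt/(_ _ (exprn_gt0 2 e0))[N _ hN] := sq0.
exists N => // k /= Nk; have /= := hN k.+1 (leqW Nk).
rewrite sub0r normrN ger0_norm ?sqr_ge0// ltr_pXn2r ?nnegrE ?(ltW e0)//.
by rewrite distrC.
Qed.

End Orbit.

End Halpern.

(** Equicontinuity makes pointwise convergence uniform on a compact set, here through the
    near-covering form of compactness. *)
Lemma opQhat_unif (R : realType) (H : normedModType R) (dot : {dot H for idfun})
    (dotxx : forall x, dot x x = `|x| ^+ 2) (rho : R)
    (cB : compact (closed_ball_ Num.norm (0 : H) rho))
    (n : nat) (G : 'I_n -> set H) (tau : R ^nat) (w : 'I_n -> R) :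
  steering_parameters tau -> positive_weights w ->
  (forall l, compact (G l)) -> (forall l, convex_set (G l)) ->
  (forall l x, G l x -> `|x| <= rho) -> \bigcap_l G l !=set0 -> (0 < n)%N ->
  forall e, 0 < e -> \forall q \near \oo, forall x, `|x| <= rho ->
    `|opQhat G tau w q x - proj (\bigcap_l G l) x| <= e.
Proof.
move=> tauP wP cG vG G_ball neC n0 e e0.
have e3 : 0 < e / 3 by rewrite divr_gt0.
have cC := closed_bigcap_compact cG n0; have vC := bigcap_convex vG.
have ballE (x : H) : closed_ball_ Num.norm 0 rho x = (`|x| <= rho) :> Prop.
  by rewrite /closed_ball_/= sub0r normrN.
have /near_covering_withinP cov := (compact_near_coveringP _).1 cB.
have [|N _ hN] := cov _ \oo
    (fun q x => `|opQhat G tau w q x - proj (\bigcap_l G l) x| <= e) _.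
  move=> x; rewrite ballE => xrho.
  have /cvgrPdist_le/(_ _ e3) Qx :=
    opQ_cvg dotxx cB tauP wP cG vG G_ball neC xrho xrho n0.
  (* Moving from [x'] to [x] costs $e/3$ for [opQhat] and $e/3$ for the projection; convergence at
     [x] costs the third. *)
  exists (ball x (e / 3),
    [set q | `|proj (\bigcap_l G l) x - opQ G tau w q x x| <= e / 3]).
    by split => //=; exact: nbhsx_ballx.
  move=> [x' q] [/=]; rewrite -ball_normE /= => xx' Qqx _.
  have QQ := opQ_nonexp dotxx tauP wP cG vG neC q (lexx `|x - x'|).
  have PP := proj_nonexp dotxx cC vC neC x x'.
  rewrite /opQhat -(_ : (opQ G tau w q x' x' - opQ G tau w q x x)
    + (opQ G tau w q x x - proj (\bigcap_l G l) x)
    + (proj (\bigcap_l G l) x - proj (\bigcap_l G l) x') =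
    opQ G tau w q x' x' - proj (\bigcap_l G l) x');
    last by vector_ring dotxx.
  apply: le_trans (ler_normD _ _) _.
  have := ler_normD (opQ G tau w q x' x' - opQ G tau w q x x)
    (opQ G tau w q x x - proj (\bigcap_l G l) x).
  rewrite (distrC (opQ _ _ _ q x' x')) (distrC _ (proj _ x)) => h.
  by lra.
by exists N => // q /= Nq x xrho; apply: hN => //; rewrite ballE.
Qed.

(** * Best approximation pairs and alternating projections *)

Section BestApproximation.
Variables (R : realType) (H : normedModType R) (dot : {dot H for idfun}).
Hypothesis dotxx : forall x, dot x x = `|x| ^+ 2.
Implicit Types (A B : set H) (a b x y z : H).

Lemma dist_le A B x y : A x -> B y -> dist A B <= `|x - y|.
Proof.
move=> Ax By; apply: ge_inf; last by exists x => //; exists y.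
by exists 0 => _ [u _ [v _ <-]].
Qed.

Lemma distAC A B : dist A B = dist B A.
Proof.
by congr inf; apply/seteqP; split => _ [u Au [v Bv <-]];
  exists v => //; exists u => //; rewrite distrC.
Qed.

Lemma best_approx_pair_sym A B a b :
  best_approx_pair A B (a, b) -> best_approx_pair B A (b, a).
Proof. by case=> /= Aa Bb e; split => //=; rewrite distrC distAC. Qed.

Lemma best_approx_pair_proj A B a b : convex_set A ->
  best_approx_pair A B (a, b) -> proj A b = a.
Proof.
move=> vA [/= Aa Bb e]; apply: (proj_eq dotxx) => //; split => // y Ay.
by rewrite distrC e distrC; exact: dist_le.
Qed.

(** The continuous function $y\mapsto\|P_Ay-y\|$ attains its minimum on the compact set [B]. *)
Lemma best_approx_pair_exists A B : compact A -> convex_set A -> A !=set0 ->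
  compact B -> B !=set0 -> exists a b, best_approx_pair A B (a, b).
Proof.
move=> cA vA neA cB neB.
have [|b] := @compact_EVT_min _ _ (fun y => `|proj A y - y|) _ neB cB.
  apply: continuous_subspaceT => x; apply: cvg_norm.
  apply: cvgB; last exact: cvg_id.
  apply/cvgrPdist_le => e e0; near=> y.
  apply: le_trans (proj_nonexp dotxx cA vA neA _ _) _; near: y.
  by apply: cvgr_dist_le => //; exact: cvg_id.
rewrite inE => Bb bmin; exists (proj A b), b; split => //=; first exact: proj_in.
apply/eqP; rewrite eq_le; apply/andP; split; last first.
  by apply: dist_le => //; exact: proj_in.
apply: lb_le_inf.
  by exists `|proj A b - b|; exists (proj A b); [exact: proj_in|exists b].
move=> _ [u Au [v Bv <-]]; apply: le_trans (bmin v _) _; first by rewrite inE.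
by rewrite distrC (distrC u); exact: (nearest_proj v cA neA).2.
Unshelve. all: by end_near. Qed.

(* The midpoint of two distinct points of A realizing the distance to B would
   be interior to A, and could be moved closer to B. *)
Lemma strictly_convex_best_approx_uniq (n : nat) (G : 'I_n -> set H) B a b a' b' :
  (forall l, convex_set (G l)) -> (forall l, strictly_convex (G l)) ->
  convex_set B -> \bigcap_l G l `&` B = set0 ->
  best_approx_pair (\bigcap_l G l) B (a, b) ->
  best_approx_pair (\bigcap_l G l) B (a', b') -> a = a'.
Proof.
move=> vG sG vB GB0 [/= Ga Bb eab] [/= Ga' Bb' eab'].
apply/eqP; apply/negP => /negP aa'.
have h01 : 0 < (2^-1 : R) < 1 by apply/andP; split; lra.
pose m := 2^-1 *: a + (1 - 2^-1) *: a'.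
pose q := 2^-1 *: b + (1 - 2^-1) *: b'.
have Bq : B q.
  by apply: convex_set_combine => //; case/andP: h01 => /ltW -> /ltW ->.
(* Finitely many interiors share a ball around [m]. *)
have : \near m, forall l, G l m.
  apply: filter_forall => l; apply: (sG l _ _ _ _ aa' _ h01); [exact: Ga|exact: Ga'].
move=> /nbhs_ballP[r /= r0 rG].
have mq : m != q.
  apply: contra_eqN GB0 => /eqP mq; apply/set0P; exists q; split => // l _.
  by rewrite -mq; apply: rG; exact: ballxx.
pose N := `|q - m|; have N0 : 0 < N by rewrite normr_gt0 subr_eq0 eq_sym.
have rN : 0 < r + N by lra.
(* A move of length $tN<r$ stays in that ball, and $t<1$ keeps the factor $1-t$ positive. *)
pose t := r / (r + N).
have t0 : 0 < t by rewrite divr_gt0.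
have tN : t * (r + N) = r by rewrite divfK// gt_eqF.
have t1 : t < 1 by rewrite ltr_pdivrMr// mul1r; lra.
have Gm : (\bigcap_l G l) (m + t *: (q - m)).
  move=> l _; apply: rG; rewrite -ball_normE /= opprD addrA subrr sub0r normrN.
  by rewrite normrZ gtr0_norm// -/N; nra.
have := dist_le Gm Bq.
have -> : m + t *: (q - m) - q = (1 - t) *: (m - q) by vector_ring dotxx.
rewrite normrZ gtr0_norm ?subr_gt0// (distrC m) -/N.
have : N <= dist (\bigcap_l G l) B.
  have -> : N = `|2^-1 *: (a - b) + (1 - 2^-1) *: (a' - b')|.
    by rewrite /N distrC; congr `|_|; rewrite /m /q; vector_ring dotxx.
  apply: le_trans (ler_normD _ _) _; rewrite !normrZ eab eab'.
  rewrite !gtr0_norm; lra.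
have := mulr_gt0 t0 N0.
by lra.
Qed.

End BestApproximation.

(** * Convergence of inexact alternating projections *)

Lemma cvg_even_odd (T : topologicalType) (f : nat -> T) (l : T) :
  f k.*2 @[k --> \oo] --> l -> f k.*2.+1 @[k --> \oo] --> l ->
  f k @[k --> \oo] --> l.
Proof.
move=> fe fo U /[dup] /fe[N1 _ h1] /fo[N2 _ h2].
exists (maxn N1 N2).*2.+1 => // k /= hk.
have hk2 : (maxn N1 N2 <= k./2)%N by rewrite -(doubleK (maxn _ _)) half_leq// ltnW.
rewrite -(odd_double_half k); case: (odd k).
  by apply: h2; rewrite /= (leq_trans _ hk2)// leq_maxr.
by apply: h1; rewrite /= (leq_trans _ hk2)// leq_maxl.
Qed.

(** Drops by the fixed amount [eta] bring the sequence to level [e] in finitely many steps, and it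
    never rises above that level again. *)
Lemma descent_eventually_le (R : realType) (r : R ^nat) (e eta : R) (N : nat) :
  0 < eta ->
  (forall k, (N <= k)%N -> r k.+1 <= Num.max e (r k - eta)) ->
  \forall k \near \oo, r k <= e.
Proof.
move=> eta0 rS.
have ind n : r (N + n)%N <= Num.max e (r N - n%:R * eta).
  elim: n => [|n IH]; first by rewrite addn0 mul0r subr0 le_max lexx orbT.
  rewrite addnS; apply: le_trans (rS _ (leq_addr _ _)) _.
  rewrite ge_max le_max lexx /=.
  move: IH; rewrite !le_max => /orP[IH|IH].
    by rewrite (_ : r _ - eta <= e)//; lra.
  by apply/orP; right; rewrite mulrSr mulrDl mul1r; lra.
have [n hn] : exists n : nat, r N - n%:R * eta <= e.
  exists (Num.Def.archi_bound `|(r N - e) / eta|).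
  have := le_lt_trans (ler_norm _) (archi_boundP (normr_ge0 ((r N - e) / eta))).
  by rewrite ltr_pdivrMr//; lra.
exists (N + n)%N => // k /= hk.
have Nk : (N <= k)%N by apply: leq_trans hk; exact: leq_addr.
have := ind (k - N)%N; rewrite subnKC// => /le_trans; apply.
rewrite ge_max lexx /=; apply: le_trans hn; rewrite lerD2l lerN2 ler_wpM2r ?(ltW eta0)//.
by rewrite ler_nat leq_subRL.
Qed.

Section Alternating.
Variables (R : realType) (H : normedModType R) (dot : {dot H for idfun}).
Hypothesis dotxx : forall x, dot x x = `|x| ^+ 2.
Variables (rho : R) (A B : set H) (a b : H).
Hypothesis cball : compact (closed_ball_ Num.norm (0 : H) rho).
Hypotheses (cA : compact A) (vA : convex_set A) (neA : A !=set0).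
Hypotheses (cB : compact B) (vB : convex_set B) (neB : B !=set0).
Hypothesis B_ball : forall x, B x -> `|x| <= rho.
Hypotheses (best : best_approx_pair A B (a, b))
  (uniq_b : forall ab, best_approx_pair A B ab -> ab.2 = b).

Let projAb : proj A b = a.
Proof. exact: (best_approx_pair_proj dotxx vA best). Qed.

Let projBa : proj B a = b.
Proof. exact: (best_approx_pair_proj dotxx vB (best_approx_pair_sym best)). Qed.

(** Without decrease, [proj_firm] forces $z-b=P_Az-a$, so $(P_Az,z)$ also realizes the distance, and
    uniqueness gives $z=b$. *)
Lemma alternating_proj_lt z : B z -> z != b ->
  `|proj B (proj A z) - b| < `|z - b|.
Proof.
move=> Bz; apply: contra_neqT; rewrite -leNgt => zb.
apply: (uniq_b (ab := (proj A z, z))); split => //=; first exact: proj_in.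
have := proj_firm dotxx cA vA neA z b; rewrite projAb => hA.
have : `|proj B (proj A z) - b| <= `|proj A z - a|.
  by rewrite -projBa; exact: (proj_nonexp dotxx).
move=> /(le_trans zb); rewrite -(@ler_pXn2r _ 2) ?nnegrE// => zA.
have : `|(z - b) - (proj A z - a)| ^+ 2 <= 0 by lra.
rewrite le_eqVlt ltNge sqr_ge0 orbF sqrf_eq0 normr_eq0 subr_eq0 => /eqP e.
have [_ _ <-] := best; rewrite /= distrC -[RHS]normrN.
congr `|_|; transitivity ((z - b) - (proj A z - a) + (b - a)).
  by vector_ring dotxx.
by rewrite e subrr add0r opprB.
Qed.

Lemma inexact_alternating_proj_cvg (u v : nat -> H) :
  (v k - proj A (u k)) @[k --> \oo] --> 0 ->
  (u k.+1 - proj B (v k)) @[k --> \oo] --> 0 ->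
  (u k @[k --> \oo] --> b) /\ (v k @[k --> \oo] --> a).
Proof.
move=> vu uv.
pose TT x := proj B (proj A x).
have TTb : TT b = b by rewrite /TT projAb projBa.
have TTle x y : `|TT x - TT y| <= `|x - y|.
  by apply: le_trans (proj_nonexp dotxx cB vB neB _ _) _; exact: (proj_nonexp dotxx).
have TTc : continuous TT.
  move=> x; apply/cvgrPdist_le => e e0; near=> y.
  apply: le_trans (TTle _ _) _; near: y.
  by apply: cvgr_dist_le => //; exact: cvg_id.
have uTT : (u k.+1 - TT (u k)) @[k --> \oo] --> 0.
  apply/cvgrPdist_le => e e0.
  have e2 : 0 < e / 2 by rewrite divr_gt0.
  have /cvgrPdist_le/(_ _ e2)[N1 _ h1] := vu.
  have /cvgrPdist_le/(_ _ e2)[N2 _ h2] := uv.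
  exists (maxn N1 N2) => // k /=; rewrite geq_max => /andP[/h1/= k1 /h2/= k2].
  have := proj_nonexp dotxx cB vB neB (v k) (proj A (u k)).
  have -> : 0 - (u k.+1 - TT (u k)) = (0 - (u k.+1 - proj B (v k)))
      - (proj B (v k) - TT (u k)).
    by vector_ring dotxx.
  have := ler_normB (0 - (u k.+1 - proj B (v k))) (proj B (v k) - TT (u k)).
  by rewrite sub0r normrN in k1; rewrite -/(TT _); lra.
(* The points [TT (u k)] are followed instead of [u k]: they lie in [B], where the strict decrease
   applies. *)
have zcvg e : 0 < e -> \forall k \near \oo, `|TT (u k) - b| <= 2 * e.
  move=> e0; pose K := B `&` [set z | e <= `|z - b|].
  have clK : closed K.
    apply: closedI; first by apply: compact_closed => //; exact: norm_hausdorff.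
    have /continuous_closedP cf : continuous (fun z => `|z - b|).
      by move=> z; apply: cvg_norm; apply: cvgB; [exact: cvg_id|exact: cvg_cst].
    exact: (cf _ (@closed_ge _ e)).
  have [||eta eta0 etaP] := @compact_ball_lower_bound _ _ _ cball K
      (fun z => `|z - b| - `|TT z - b|) clK.
  - move=> z; apply: cvgB; apply: cvg_norm; apply: cvgB.
    + exact: cvg_id.
    + exact: cvg_cst.
    + exact: TTc.
    + exact: cvg_cst.
  - move=> z _ [Bz /= ez]; rewrite subr_gt0; apply: alternating_proj_lt => //.
    by rewrite -subr_eq0 -normr_gt0 (lt_le_trans e0).
  (* Far from [b], an error [eta / 2] leaves a net decrease [eta / 2]; within [e] of [b], an error
     [e] keeps the distance below [2 * e]. *)
  pose d := Num.min e (eta / 2).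
  have d0 : 0 < d by rewrite lt_min e0 divr_gt0.
  have [de dh] : d <= e /\ d <= eta / 2 by split; rewrite ge_min lexx ?orbT.
  have /cvgrPdist_le/(_ _ d0)[N _ hN] := uTT.
  apply: (@descent_eventually_le _ _ _ (eta / 2) N); first by rewrite divr_gt0.
  move=> k Nk; have /= := hN k Nk; rewrite sub0r normrN => huk.
  have h1 := TTle (u k.+1) (TT (u k)).
  have h2 := ler_normD (TT (u k.+1) - TT (TT (u k))) (TT (TT (u k)) - b).
  rewrite addrA subrK in h2.
  have h3 := TTle (TT (u k)) b; rewrite TTb in h3.
  have BT : B (TT (u k)) by exact: proj_in.
  rewrite le_max; have [le_e|lt_e] := leP e (`|TT (u k) - b|).
    apply/orP; right.
    have /= := etaP _ (B_ball BT) (conj BT le_e).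
    by lra.
  by apply/orP; left; lra.
have ub : u k @[k --> \oo] --> b.
  have : u k.+1 @[k --> \oo] --> b.
    apply/cvgrPdist_le => e e0.
    have e4 : 0 < e / 4 by rewrite divr_gt0.
    have [N1 _ h1] := zcvg _ e4.
    have e2 : 0 < e / 2 by rewrite divr_gt0.
    have /cvgrPdist_le/(_ _ e2)[N2 _ h2] := uTT.
    exists (maxn N1 N2) => // k /=; rewrite geq_max => /andP[/h1/= k1 /h2/= k2].
    rewrite sub0r normrN in k2.
    have := ler_normD (u k.+1 - TT (u k)) (TT (u k) - b).
    by rewrite addrA subrK (distrC b); lra.
  by rewrite cvg_shiftS.
split => //.
have pA : proj A (u k) @[k --> \oo] --> a.
  apply/cvgrPdist_le => e e0; have /cvgrPdist_le/(_ _ e0)[N _ hN] := ub.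
  exists N => // k /hN /=; apply: le_trans.
  by rewrite -projAb; exact: (proj_nonexp dotxx).
exact: (cvg_sub0 (f := v) vu pA).
Unshelve. all: by end_near. Qed.

End Alternating.

(** * Convergence of the A-S-HLWB algorithm *)

Theorem theorem33 (R : realType) (H : normedModType R)
    (dot : {dot H for idfun}) (euclH : euclidean dot)
    (I J : nat) (I_gt0 : (0 < I)%N) (J_gt0 : (0 < J)%N)
    (Ai : 'I_I -> set H) (Bj : 'I_J -> set H)
    (Ai_closed : forall i, closed (Ai i)) (Ai_convex : forall i, convex_set (Ai i))
    (Bj_closed : forall j, closed (Bj j)) (Bj_convex : forall j, convex_set (Bj j))
    (tauA tauB : R ^nat)
    (tauA_steer : steering_parameters tauA) (tauB_steer : steering_parameters tauB)
    (alpha : 'I_I -> R) (beta : 'I_J -> R)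
    (alpha_w : positive_weights alpha) (beta_w : positive_weights beta)
    (A B : set H) (defA : A = \bigcap_i Ai i) (defB : B = \bigcap_j Bj j)
    (A_neq0 : A !=set0) (B_neq0 : B !=set0) (AB_disj : A `&` B = set0)
    (rho : R) (rho_gt0 : 0 < rho)
    (Ai_bounded : forall i, Ai i `<=` closed_ball_ Num.norm 0 rho)
    (Bj_bounded : forall j, Bj j `<=` closed_ball_ Num.norm 0 rho)
    (unique_or_strict :
       (exists! ab : H * H, best_approx_pair A B ab) \/
       ((forall i, strictly_convex (Ai i)) /\ (forall j, strictly_convex (Bj j))))
    (x : nat -> H) (x0_ball : closed_ball_ Num.norm 0 rho (x 0%N))
    (x_even : forall k, ~~ odd k -> x k.+1 = opQhat Ai tauA alpha k./2 (x k))
    (x_odd : forall k, odd k -> x k.+1 = opQhat Bj tauB beta k.-1./2 (x k)) :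
  (`|x k.+1 - x k| @[k --> \oo] --> dist A B) /\
  (exists a b : H,
     [/\ A a, B b,
         x k.*2.+1 @[k --> \oo] --> a,
         x k.*2 @[k --> \oo] --> b &
         best_approx_pair A B (a, b)]).
Proof.
have [dotxx finH] := euclH.
have cball := @compact_closed_ball0 _ _ _ dotxx finH rho.
have cAi i : compact (Ai i) by apply: (subclosed_compact _ cball) => //.
have cBj j : compact (Bj j) by apply: (subclosed_compact _ cball) => //.
have ballE (z : H) : closed_ball_ Num.norm 0 rho z = (`|z| <= rho) :> Prop.
  by rewrite /closed_ball_/= sub0r normrN.
have Ai_ball i z : Ai i z -> `|z| <= rho by move=> /Ai_bounded; rewrite ballE.
have Bj_ball j z : Bj j z -> `|z| <= rho by move=> /Bj_bounded; rewrite ballE.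
have cA : compact A by rewrite defA; exact: closed_bigcap_compact.
have cB : compact B by rewrite defB; exact: closed_bigcap_compact.
have vA : convex_set A by rewrite defA; exact: bigcap_convex.
have vB : convex_set B by rewrite defB; exact: bigcap_convex.
have neAi : \bigcap_i Ai i !=set0 by rewrite -defA.
have neBj : \bigcap_j Bj j !=set0 by rewrite -defB.
have B_ball z : B z -> `|z| <= rho.
  by rewrite defB => /(_ (Ordinal J_gt0) Logic.I)/Bj_ball.
(* Both alternatives are reduced to a best approximation pair with a unique [B]-component. *)
have [a [b [best uniq_b]]] : exists a b, best_approx_pair A B (a, b) /\
    forall ab, best_approx_pair A B ab -> ab.2 = b.
  case: unique_or_strict => [[[a b] [best uniq]]|[_ sB]].
    by exists a, b; split => // ab /uniq <-.
  have [a [b best]] := best_approx_pair_exists dotxx cA vA A_neq0 cB B_neq0.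
  exists a, b; split => // -[a' b'] best' /=.
  (* The pairs are swapped so that strict convexity of the [Bj] identifies the [B]-components. *)
  move: best best' => /best_approx_pair_sym + /best_approx_pair_sym.
  rewrite defB => best best'.
  apply: (strictly_convex_best_approx_uniq dotxx Bj_convex sB vA _ best' best).
  by rewrite -defB setIC.
pose u k := x k.*2; pose v k := x k.*2.+1.
have vE k : v k = opQhat Ai tauA alpha k (u k).
  by rewrite /v x_even ?odd_double// doubleK.
have uE k : u k.+1 = opQhat Bj tauB beta k (v k).
  by rewrite /u doubleS x_odd /= ?odd_double// doubleK.
have u_ball k : `|u k| <= rho.
  elim: k => [|k IH]; first by rewrite -ballE.
  rewrite uE; apply: (opQ_ball tauB_steer beta_w cBj Bj_ball neBj).
  by rewrite vE; apply: (opQ_ball tauA_steer alpha_w cAi Ai_ball neAi).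
have v_ball k : `|v k| <= rho.
  by rewrite vE; apply: (opQ_ball tauA_steer alpha_w cAi Ai_ball neAi).
have vu : (v k - proj A (u k)) @[k --> \oo] --> 0.
  apply/cvgrPdist_le => e e0.
  have [N _ hN] := opQhat_unif dotxx cball tauA_steer alpha_w cAi Ai_convex
    Ai_ball neAi I_gt0 e0.
  exists N => // k /hN/= hk; rewrite sub0r normrN vE defA; exact: hk.
have uv : (u k.+1 - proj B (v k)) @[k --> \oo] --> 0.
  apply/cvgrPdist_le => e e0.
  have [N _ hN] := opQhat_unif dotxx cball tauB_steer beta_w cBj Bj_convex
    Bj_ball neBj J_gt0 e0.
  exists N => // k /hN/= hk; rewrite sub0r normrN uE defB; exact: hk.
have [ub va] := inexact_alternating_proj_cvg dotxx cball cA vA A_neq0 cB vB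
  B_neq0 B_ball best uniq_b vu uv.
have [Aa Bb ab] := best.
split; last by exists a, b; split.
(* Step lengths with even and with odd index both tend to $\|a-b\|$. *)
apply: cvg_even_odd; rewrite -ab /=.
  by apply: cvg_norm; apply: cvgB.
rewrite distrC; apply: cvg_norm; apply: cvgB => //.
have : u k.+1 @[k --> \oo] --> b by rewrite cvg_shiftS.
by rewrite /u; under eq_fun do rewrite doubleS.
Qed.
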